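(* Let $G$ be an Integer Programming Game instance and let $f$ be a function of the strategy profile $x$, linearizable to a linear function $f(x,z)$ in the lifted space, such that the problem $\max\{f(x,z) : (x,z)\in\mathcal{K}\}$ is feasible and bounded. Then the algorithm ZERO Regrets (described in the context), run on input $(G,f)$, terminates after finitely many iterations, and it is correct: if $G$ has a pure Nash equilibrium, it returns a pure Nash equilibrium $\ddot{x}$ maximizing $f$ among all pure Nash equilibria of $G$; otherwise, it reports that $G$ has no pure Nash equilibrium.
   Context: Integer Programming Game (IPG): there are $n$ players; each player $i$ controls a vector $x^i$ of $m$ integer variables and solves $\max_{x^i}\{u^i(x^i,x^{-i}) : x^i \in \mathcal{X}^i\}$ with $\mathcal{X}^i := \{x^i \in \mathbb{Z}^m : A^i x^i \le b^i\}$, where $A^i \in \mathbb{Z}^{r\times m}$, $b^i \in \mathbb{Z}^r$, and $u^i(x^i,x^{-i})$, given $x^{-i}$, is a function in $x^i$ with integer coefficients. Here $x^{-i} = (x^1,\dots,x^{i-1},x^{i+1},\dots,x^n)$. All variables are lower and upper bounded, so each $\mathcal{X}^i$ is finite. A strategy profile is $x=(x^1,\dots,x^n)$ with $x^i \in \mathcal{X}^i$ for all $i$. A pure Nash equilibrium is a strategy profile $\bar{x}$ such that $u^i(\bar{x}^i,\bar{x}^{-i}) \ge u^i(\hat{x}^i,\bar{x}^{-i})$ for every player $i$ and every $\hat{x}^i \in \mathcal{X}^i$. Lifted space: it is assumed that the non-linear terms in the functions $u^i$ (and $f$) can be linearized with finitely many auxiliary variables $z$ and finitely many linear constraints. Let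 $\mathcal{L}$ denote the set of points $(x,z)$ satisfying these linear constraints together with the integrality requirements and bounds on the $z$ variables, and let $\mathcal{K} = \{(x^1,\dots,x^n,z) \in \mathcal{L} : x^i \in \mathcal{X}^i \text{ for all } i\}$. Each strategy profile $x$ induces a unique $z$ with $(x,z)\in\mathcal{K}$; on $\mathcal{K}$ the linear expressions for $u^i$ and $f$ in $(x,z)$ agree with the original functions of $x$. Equilibrium separation oracle: given $(\bar{x},\bar{z})\in\mathcal{K}$, set $\phi=\emptyset$; for each player $i=1,\dots,n$, compute a maximizer $\hat{x}^i$ of $\max_{x^i}\{u^i(x^i,\bar{x}^{-i}) : x^i\in\mathcal{X}^i\}$, and if $u^i(\hat{x}^i,\bar{x}^{-i}) > u^i(\bar{x}^i,\bar{x}^{-i})$, add the inequality $u^i(\hat{x}^i,x^{-i}) \le u^i(x^i,x^{-i})$ to $\phi$. If $\phi=\emptyset$ return ''yes''; otherwise return ''no'' and $\phi$. ZERO Regrets algorithm: start with the set of inequalities $\Phi=\{0\le 1\}$ and let $\mathcal{Q}$ be the problem $\max\{f(x,z) : (x,z)\in\mathcal{K},\ (x,z) \text{ satisfies all inequalities in } \Phi\}$. Repeat: if $\mathcal{Q}$ is infeasible, return ''no PNE''; otherwise compute an optimal solution $(\bar{x},\bar{z})$ of $\mathcal{Q}$ and call the equilibrium separation oracle on it; if the oracle answers ''yes'', return $\ddot{x}=\bar{x}$; if it answers ''no'' with a set $\phi$, add $\phi$ to $\Phi$ and continue with the next iteration. *)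

(* Defs.v *)
From mathcomp Require Import all_boot all_order all_algebra.
From mathcomp Require Import reals.
From Stdlib Require Import Relation_Operators.

Set Implicit Arguments.
Unset Strict Implicit.
Unset Printing Implicit Defensive.

Import Order.TTheory GRing.Theory Num.Theory.
Local Open Scope ring_scope.

Definition strategy (m : nat) : Type := 'cV[int]_m.

Definition profile (n m : nat) : Type := {ffun 'I_n -> 'cV[int]_m}.

(* (y, x^{-i}) *)
Definition deviate n m (x : profile n m) (i : 'I_n) (y : strategy m) :
    profile n m :=
  [ffun k => if k == i then y else x k].

(* [coef] and [term] present u^i(., x^{-i}) as a combination of (possibly
   nonlinear) terms in x^i whose coefficients are integers depending on x^{-i}
   only; no particular shape (e.g. polynomial) is imposed on the terms. *)
Record ipg (R : realType) (n m r : nat) := IPG {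
  mxA : 'I_n -> 'M[int]_(r, m);
  vecb : 'I_n -> 'cV[int]_r;
  nterms : 'I_n -> nat;
  coef : forall i : 'I_n, 'I_(nterms i) -> profile n m -> int;
  term : forall i : 'I_n, 'I_(nterms i) -> strategy m -> R;
  coef_others : forall (i : 'I_n) (k : 'I_(nterms i)) (x : profile n m)
      (y : strategy m), coef k (deviate x i y) = coef k x;
  lb : 'I_n -> strategy m;
  ub : 'I_n -> strategy m;
  bounded_vars : forall (i : 'I_n) (y : strategy m),
    (forall k, (mxA i *m y) k 0 <= vecb i k 0) ->
    forall j, lb i j 0 <= y j 0 <= ub i j 0
}.

Section Game.
Variables (R : realType) (n m r : nat) (G : ipg R n m r).

(* y \in X^i *)
Definition feasible_strategy (i : 'I_n) (y : strategy m) : Prop :=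
  forall k, (mxA G i *m y) k 0 <= vecb G i k 0.

Definition payoff (i : 'I_n) (x : profile n m) : R :=
  \sum_(k < nterms G i) (coef k x)%:~R * term k (x i).

Definition strategy_profile (x : profile n m) : Prop :=
  forall i, feasible_strategy i (x i).

Definition PNE (x : profile n m) : Prop :=
  strategy_profile x /\
  forall i y, feasible_strategy i y -> payoff i (deviate x i y) <= payoff i x.

End Game.

Definition lifted (R : realType) (n m p : nat) : Type :=
  (profile n m * 'cV[R]_p)%type.

(* Linear expressions in (x, z), a constant term being allowed. *)
Record linexpr (R : realType) (n m p : nat) := LinExpr {
  le_const : R;
  le_x : 'I_n -> 'rV[R]_m;
  le_z : 'rV[R]_p
}.

Definition leval (R : realType) n m p (e : linexpr R n m p)
    (w : lifted R n m p) : R :=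
  le_const e
  + \sum_(i < n) \sum_(j < m) le_x e i 0 j * (w.1 i j 0)%:~R
  + \sum_(j < p) le_z e 0 j * w.2 j 0.

(* The set L: q linear constraints, each written [expression <= 0], together
   with bounds on z and integrality of the z_j with [zint j]. *)
Record lifting (R : realType) (n m p q : nat) := Lifting {
  constr : 'I_q -> linexpr R n m p;
  zint : pred 'I_p;
  zlb : 'cV[R]_p;
  zub : 'cV[R]_p
}.

Definition in_L (R : realType) n m p q (L : lifting R n m p q)
    (w : lifted R n m p) : Prop :=
  [/\ forall k, leval (constr L k) w <= 0,
      forall j, zint L j -> w.2 j 0 \is a Num.int
    & forall j, zlb L j 0 <= w.2 j 0 <= zub L j 0].

Definition in_K (R : realType) n m r p q (G : ipg R n m r)
    (L : lifting R n m p q) (w : lifted R n m p) : Prop :=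
  in_L L w /\ strategy_profile G w.1.

Record linearization (R : realType) (n m r p q : nat) (G : ipg R n m r)
    (f : profile n m -> R) := Linearization {
  lift_of :> lifting R n m p q;
  lift_unique : forall x : profile n m, strategy_profile G x ->
    exists! z : 'cV[R]_p, in_K G lift_of (x, z);
  payoff_lin : 'I_n -> linexpr R n m p;
  payoff_linP : forall (i : 'I_n) (w : lifted R n m p), in_K G lift_of w ->
    leval (payoff_lin i) w = payoff G i w.1;
  obj_lin : linexpr R n m p;
  obj_linP : forall w : lifted R n m p, in_K G lift_of w ->
    leval obj_lin w = f w.1
}.

Section Algorithm.
Variables (R : realType) (n m r p q : nat) (G : ipg R n m r).
Variables (f : profile n m -> R) (Lf : linearization p q G f).

(* An inequality lhs <= rhs over the lifted space. *)
Definition ineq : Type :=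
  ((lifted R n m p -> R) * (lifted R n m p -> R))%type.

Definition sat (c : ineq) (w : lifted R n m p) : bool := c.1 w <= c.2 w.

Definition ineq01 : ineq := (fun=> 0, fun=> 1).

(* u^i(y, x^{-i}) <= u^i(x^i, x^{-i}), for a fixed y *)
Definition equilibrium_ineq (i : 'I_n) (y : strategy m) : ineq :=
  (fun w => payoff G i (deviate w.1 i y), fun w => payoff G i w.1).

Definition best_response (i : 'I_n) (x : profile n m) (y : strategy m) : Prop :=
  feasible_strategy G i y /\
  forall y', feasible_strategy G i y' ->
    payoff G i (deviate x i y') <= payoff G i (deviate x i y).

(* The set phi collected on input x when the maximizers found are yhat. *)
Definition oracle_cuts (x : profile n m) (yhat : 'I_n -> strategy m) :
    seq ineq :=
  [seq equilibrium_ineq i (yhat i) | i <- enum 'I_n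
     & payoff G i x < payoff G i (deviate x i (yhat i))].

(* [Some phi] is the answer "no" with phi, [None] the answer "yes". The oracle
   is a relation since maximizers need not be unique. *)
Inductive oracle (w : lifted R n m p) : option (seq ineq) -> Prop :=
| OracleYes yhat : (forall i, best_response i w.1 (yhat i)) ->
    nilp (oracle_cuts w.1 yhat) -> oracle w None
| OracleNo yhat : (forall i, best_response i w.1 (yhat i)) ->
    ~~ nilp (oracle_cuts w.1 yhat) -> oracle w (Some (oracle_cuts w.1 yhat)).

Definition feasible_Q (Phi : seq ineq) (w : lifted R n m p) : Prop :=
  in_K G Lf w /\ all (fun c => sat c w) Phi.

Definition optimal_Q (Phi : seq ineq) (w : lifted R n m p) : Prop :=
  feasible_Q Phi w /\
  forall w', feasible_Q Phi w' -> leval (obj_lin Lf) w' <= leval (obj_lin Lf) w.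

Inductive outcome : Type :=
| NoPNE
| Return of profile n m.

Inductive state : Type :=
| Iterate of seq ineq
| Halt of outcome.

Definition zr_init : state := Iterate [:: ineq01].

(* One iteration; any optimal solution of Q and any oracle answer may occur. *)
Inductive zr_step : state -> state -> Prop :=
| ZRInfeasible Phi : (forall w, ~ feasible_Q Phi w) ->
    zr_step (Iterate Phi) (Halt NoPNE)
| ZRYes Phi w : optimal_Q Phi w -> oracle w None ->
    zr_step (Iterate Phi) (Halt (Return w.1))
| ZRNo Phi w phi : optimal_Q Phi w -> oracle w (Some phi) ->
    zr_step (Iterate Phi) (Iterate (Phi ++ phi)).

Definition zr_reachable (s : state) : Prop :=
  clos_refl_trans state zr_step zr_init s.

(* Every run is finite, and a run can only stop by halting: as long as it has
   not halted, Q is infeasible or has an optimum, and the oracle answers. *)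
Definition zr_terminates : Prop :=
  Acc (fun s' s => zr_step s s') zr_init /\
  forall Phi, zr_reachable (Iterate Phi) -> exists s, zr_step (Iterate Phi) s.

Definition zr_returns (o : outcome) : Prop := zr_reachable (Halt o).

End Algorithm.

Arguments NoPNE {n m}.
Arguments Return {n m} _.

(* Main.v *)
Require Import Defs.
From mathcomp Require Import all_boot all_order all_algebra.
From mathcomp Require Import boolp reals.
Import Order.TTheory GRing.Theory Num.Theory.
Local Open Scope ring_scope.

(** There are finitely many strategy profiles because all variables are
    bounded.  A "no" answer at [w] adds a cut violated by every lifted point
    with the same profile as [w]: cuts only involve the profile.  So no profile
    is visited twice and the run is finite.  A PNE satisfies every cut, hence is
    never cut off; when the oracle says "yes" the current point is a PNE
    maximizing [f] over a relaxation that contains every PNE. *)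

(** [P] is decided classically to filter [s]; the maximum is then taken over positions in the
    filtered list, which form a finite type although [T] need not. *)
Lemma finite_argmax (R : realType) (T : eqType) (s : seq T) (P : T -> Prop)
    (f : T -> R) :
  (forall x, P x -> x \in s) -> (exists x, P x) ->
  exists2 x, P x & forall y, P y -> f y <= f x.
Proof.
move=> Ps [x0 Px0].
pose t := [seq x <- s | `[< P x >]].
have tP x : x \in t <-> P x.
  rewrite mem_filter; split=> [/andP[/asboolP]//|Px].
  by rewrite Ps // andbT; apply/asboolP.
have lt0 : (index x0 t < size t)%N by rewrite index_mem; apply/tP.
case: (@arg_maxP _ R _ (Ordinal lt0) predT (fun i => f (nth x0 t i))) => //.
move=> i _ imax; exists (nth x0 t i); first by apply/tP/mem_nth.
move=> y /tP yt; have lty : (index y t < size t)%N by rewrite index_mem.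
by have := imax (Ordinal lty) isT; rewrite /= nth_index.
Qed.

Section ZeroRegrets.
Set Implicit Arguments.
Unset Strict Implicit.

Variables (R : realType) (n m r p q : nat) (G : ipg R n m r).

Lemma deviateE (x : profile n m) i y : deviate x i y i = y.
Proof. by rewrite ffunE eqxx. Qed.

Lemma strategy_profile_deviate x i y :
  strategy_profile G x -> feasible_strategy G i y ->
  strategy_profile G (deviate x i y).
Proof. by move=> xG yG k; rewrite ffunE; case: eqP => [->|]. Qed.

(** A profile is encoded by its offsets from the lower bounds, natural numbers at most the largest
    width [N] of a variable's range. *)
Lemma strategy_profile_finite :
  exists s : seq (profile n m), forall x, strategy_profile G x -> x \in s.
Proof.
pose N := (\max_(ij : 'I_n * 'I_m)
  `|(ub G ij.1 ij.2 0 - lb G ij.1 ij.2 0)%R|)%N.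
pose prof (g : {ffun 'I_n * 'I_m -> 'I_N.+1}) : profile n m :=
  [ffun i => \col_j (lb G i j 0 + (g (i, j) : nat)%:Z)].
exists [seq prof g | g <- enum {ffun 'I_n * 'I_m -> 'I_N.+1}] => x xG.
have xb i j := bounded_vars (xG i) j.
apply/mapP; exists [ffun ij => inord `|(x ij.1 ij.2 0 - lb G ij.1 ij.2 0)%R|%N].
  by rewrite mem_enum.
apply/ffunP=> i; apply/matrixP=> j k; rewrite ord1 !ffunE !mxE ffunE /=.
have /andP[lbx xub] := xb i j.
have d0 : 0 <= x i j 0 - lb G i j 0 by rewrite subr_ge0.
rewrite inordK; first by rewrite gez0_abs // addrC subrK.
rewrite ltnS; apply: leq_trans (leq_bigmax (i, j)) => /=.
by rewrite -lez_nat !gez0_abs ?lerB // subr_ge0 (le_trans lbx).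
Qed.

Lemma best_response_exists x : strategy_profile G x ->
  exists yhat : 'I_n -> strategy m, forall i, best_response G i x (yhat i).
Proof.
move=> xG; apply: (fin_all_exists (P := fun i y => best_response G i x y)) => i.
have [s sP] := strategy_profile_finite.
have [||y yG ymax] := @finite_argmax R _ [seq x' i | x' : profile n m <- s]
    (feasible_strategy G i) (fun y => payoff G i (deviate x i y)).
(* A feasible [y] is the [i]-th component of a strategy profile, so finiteness of profiles passes to
   strategies. *)
- move=> y yG; apply/mapP; exists (deviate x i y); last by rewrite deviateE.
  exact/sP/strategy_profile_deviate.
- by exists (x i).
- by exists y; split.
Qed.

Lemma PNE_sat_cuts x yhat (w : lifted R n m p) :
  (forall i, feasible_strategy G i (yhat i)) -> PNE G w.1 ->
  all (fun c => sat c w) (oracle_cuts p G x yhat).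
Proof.
move=> yG [_ wmax]; rewrite all_map; apply/allP => i _.
exact: wmax (yG i).
Qed.

(** A cut is collected only when [w.1] strictly violates it, so [w'], having the same profile, can
    satisfy all of them only if there are none. *)
Lemma oracle_cuts_violated yhat (w w' : lifted R n m p) : w'.1 = w.1 ->
  all (fun c => sat c w') (oracle_cuts p G w.1 yhat) ->
  nilp (oracle_cuts p G w.1 yhat).
Proof.
move=> ww'; rewrite all_map all_filter => /allP/= satw'.
rewrite /nilp size_map size_filter -leqn0 leqNgt -has_count.
apply/hasPn => i /satw'; rewrite /sat /= ww' leNgt.
by case: (_ < _).
Qed.

(** If not even a best response improves on [x i], no deviation does. *)
Lemma nil_cuts_PNE x yhat :
  strategy_profile G x -> (forall i, best_response G i x (yhat i)) ->
  nilp (oracle_cuts p G x yhat) -> PNE G x.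
Proof.
move=> xG yP; rewrite /nilp size_map size_filter -leqn0 leqNgt -has_count.
move=> /hasPn nolt; split=> // i y yG.
have := nolt i (mem_enum _ i); rewrite -leNgt; apply: le_trans.
by have [_] := yP i; apply.
Qed.

Variables (f : profile n m -> R) (Lf : linearization p q G f).

Lemma oracle_answers w : in_K G Lf w -> exists a, oracle G w a.
Proof.
case=> _ /best_response_exists[yhat yP].
have [nilc|cons] := boolP (nilp (oracle_cuts p G w.1 yhat)).
  by exists None; apply: OracleYes nilc.
by exists (Some (oracle_cuts p G w.1 yhat)); apply: OracleNo.
Qed.

(** On K the objective equals [f] of the profile, so it suffices to maximize [f] over the finitely
    many profiles that lift to a feasible point. *)
Lemma optimal_Q_exists Phi :
  (exists w, feasible_Q Lf Phi w) -> exists w, optimal_Q Lf Phi w.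
Proof.
move=> [[x0 z0] xz0]; have [s sP] := strategy_profile_finite.
have [||x [z xz] xmax] := @finite_argmax R _ s
    (fun x => exists z, feasible_Q Lf Phi (x, z)) f.
- by move=> x [z [[_ xG] _]]; apply: sP.
- by exists x0, z0.
exists (x, z); split=> // -[x' z'] xz'.
by rewrite (obj_linP xz.1) (obj_linP xz'.1); apply: xmax; exists z'.
Qed.

Lemma zr_step_exists Phi : exists s, zr_step Lf (Iterate Phi) s.
Proof.
have [/optimal_Q_exists[w wopt]|noQ] := pselect (exists w, feasible_Q Lf Phi w).
  have [[phi|] wa] := oracle_answers wopt.1.1.
    by exists (Iterate (Phi ++ phi)); apply: ZRNo wa.
  by exists (Halt _ _ (Return w.1)); apply: ZRYes wa.
by exists (Halt _ _ NoPNE); apply: ZRInfeasible => w wQ; apply: noQ; exists w.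
Qed.

(* The seq [s] over-approximates the profiles still feasible for [Phi], and a
   "no" answer at [w] allows deleting [w.1] from it. *)
Lemma Acc_zr_step (s : seq (profile n m)) Phi :
  (forall w, feasible_Q Lf Phi w -> w.1 \in s) ->
  Acc (fun s' s => zr_step Lf s s') (Iterate Phi).
Proof.
have [k] := ubnP (size s); elim: k s Phi => [//|k IHk] s Phi.
rewrite ltnS => szs Phis; constructor=> st.
have haltP o : Acc (fun s' s => zr_step Lf s s') (Halt _ _ o).
  by constructor=> ? step; inversion step.
move defPhi: (Iterate Phi) => s0 step.
case: step defPhi => [? _ _|? w _ _ _|Phi0 w phi wopt wno [defPhi]].
- exact: haltP.
- exact: haltP.
rewrite -{Phi0}defPhi in wopt *.
inversion wno as [|yhat _ cuts0 phiE].
have ws : w.1 \in s by case: wopt => wQ _; apply: Phis.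
apply: (IHk [seq x <- s | predC1 w.1 x]) => [|w' [w'K]].
  (* The list shrinks strictly because [w.1] occurs in it. *)
  rewrite size_filter; apply: leq_trans szs.
  have := count_predC (pred1 w.1) s; move: (count (predC _) s) => c <-.
  by rewrite -[ltnLHS]add0n ltn_add2r -has_count has_pred1.
rewrite all_cat => /andP[w'Phi w'phi]; rewrite mem_filter Phis // andbT.
apply: contra cuts0 => /eqP ww'.
exact: oracle_cuts_violated ww' w'phi.
Qed.

(** While iterating, no equilibrium is cut off, whatever its [z]; on halting, the outcome is
    correct. *)
Definition zr_invariant (s : state R n m p) : Prop :=
  match s with
  | Iterate Phi => forall w, PNE G w.1 -> all (fun c => sat c w) Phi
  | Halt NoPNE => ~ exists x, PNE G x
  | Halt (Return x) => PNE G x /\ forall y, PNE G y -> f y <= f x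
  end.

Lemma PNE_feasible_Q Phi x : zr_invariant (Iterate Phi) -> PNE G x ->
  exists z, feasible_Q Lf Phi (x, z).
Proof.
move=> inv xP; have [z [xzK _]] := lift_unique Lf xP.1.
by exists z; split=> //; apply: inv.
Qed.

Lemma zr_step_invariant s s' :
  zr_step Lf s s' -> zr_invariant s -> zr_invariant s'.
Proof.
case=> [Phi noQ|Phi w wopt wyes|Phi w phi wopt wno] inv /=.
- by move=> [x /(PNE_feasible_Q inv)[z /noQ]].
- have [[wK _] wmax] := wopt.
  inversion wyes as [yhat yP nilc|]; split.
    exact: nil_cuts_PNE wK.2 yP nilc.
  (* A competing equilibrium lifts to a feasible point of Q, so the optimality of [w] applies to
     it. *)
  move=> y /(PNE_feasible_Q inv)[z yzQ].
  by have := wmax _ yzQ; rewrite (obj_linP yzQ.1) (obj_linP wK).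
- inversion wno as [|yhat yP _ phiE] => w' w'P.
  rewrite all_cat inv //=; apply: PNE_sat_cuts => // i.
  by case: (yP i).
Qed.

Lemma zr_reachable_invariant s : zr_reachable Lf s -> zr_invariant s.
Proof.
move=> reach; suff: zr_invariant (zr_init R n m p) -> zr_invariant s.
  by apply=> w _; rewrite /= /sat /= ler01.
elim: reach => {s} [s s'||s1 s2 s3 _ IH12 _ IH23 /IH12/IH23] //.
exact: zr_step_invariant.
Qed.

End ZeroRegrets.

Theorem mainTheorem3 (R : realType) (n m r p q : nat) (G : ipg R n m r)
    (f : profile n m -> R) (Lf : linearization p q G f)
    (feasK : exists w : lifted R n m p, in_K G Lf w)
    (bndK : exists M : R, forall w : lifted R n m p,
        in_K G Lf w -> leval (obj_lin Lf) w <= M) :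
  zr_terminates Lf /\
  forall o : outcome n m, zr_returns Lf o ->
    ((exists x : profile n m, PNE G x) ->
      exists x : profile n m,
        [/\ o = Return x, PNE G x
          & forall y : profile n m, PNE G y -> f y <= f x])
    /\ (~ (exists x : profile n m, PNE G x) -> o = NoPNE).
Proof.
split.
  split=> [|Phi _]; last exact: zr_step_exists.
  have [s sP] := strategy_profile_finite G.
  (* The initial over-approximation is the list of all strategy profiles. *)
  by apply: (Acc_zr_step (s := s)) => w [[_ wG] _]; apply: sP.
case=> [|x] /zr_reachable_invariant /=; first by split.
by move=> [xP xmax]; split=> [_|[]]; exists x.
Qed.
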